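(* Let $\Omega=(a,b)\subset\mathbb{R}$ be a finite open interval, $0<\alpha<1$ and $1\le p<\infty$. Then $W^{1,p}_0(\Omega)\subset{}^{\pm}W^{\alpha,p}(\Omega)$ (for each of the signs $-$ and $+$). Hence $W^{1,p}_0(\Omega)\subset W^{\alpha,p}(\Omega)$.
   Context: $W_0^{1,p}(\Omega)$ is the usual closure of $C_0^\infty(\Omega)$ in the integer-order Sobolev space $W^{1,p}(\Omega)$. For $0<\alpha<1$ and $\varphi\in C_0^\infty(\mathbb{R})$: ${}^{-}D^{\alpha}\varphi(x)=\frac{1}{\Gamma(1-\alpha)}\frac{d}{dx}\int_{-\infty}^x\frac{\varphi(y)}{(x-y)^{\alpha}}dy$ and ${}^{+}D^{\alpha}\varphi(x)=\frac{-1}{\Gamma(1-\alpha)}\frac{d}{dx}\int_x^{\infty}\frac{\varphi(y)}{(y-x)^{\alpha}}dy$. For $u\in L^1(\Omega)$, $v\in L^1_{loc}(\Omega)$ is the left (resp. right) weak fractional derivative of $u$, $v={}^{-}\mathcal{D}^{\alpha}u$ (resp. ${}^{+}\mathcal{D}^{\alpha}u$), if $\int_\Omega v\varphi\,dx=\int_\Omega u\,{}^{+}D^{\alpha}\tilde\varphi\,dx$ (resp. with ${}^{-}D^{\alpha}\tilde\varphi$) for all $\varphi\in C_0^\infty(\Omega)$, where $\tilde\varphi$ is the zero extension of $\varphi$ to $\mathbb{R}$. ${}^{\pm}W^{\alpha,p}(\Omega)=\{u\in L^p(\Omega): {}^{\pm}\mathcal{D}^{\alpha}u\in L^p(\Omega)\}$,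 and the symmetric space is $W^{\alpha,p}(\Omega)={}^{-}W^{\alpha,p}(\Omega)\cap{}^{+}W^{\alpha,p}(\Omega)$. *)

(* Defs.v *)
From HB Require Import structures.
From mathcomp Require Import all_boot all_order all_algebra.
From mathcomp Require Import all_classical all_reals all_analysis.

Set Implicit Arguments.
Unset Strict Implicit.
Unset Printing Implicit Defensive.

Import Order.TTheory GRing.Theory Num.Theory.
Import numFieldNormedType.Exports.

Local Open Scope classical_set_scope.
Local Open Scope ring_scope.

(* A function on Omega is represented by a total function R -> R, of which only
   the values on Omega matter; almost-everywhere equal functions are not
   identified, so the spaces below are sets of representatives. *)
Section fractional_sobolev.
Context {R : realType}.
Implicit Types (Omega : set R) (u v phi : R -> R) (alpha p x : R).

Local Notation mu := (@lebesgue_measure R).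

(* derive1n and derive1 are written out since their postfix notations clash with
   those of the formal derivative of polynomials. *)
Definition smooth phi := forall n x, derivable (derive1n n phi) x 1.

(* An element of C_0^oo(Omega) is represented by its zero extension to R, so
   that no separate notation is needed for the extension. *)
Definition test_function Omega : set (R -> R) :=
  [set phi | let supp := closure [set x | phi x != 0] in
             [/\ smooth phi, compact supp & supp `<=` Omega]].

Definition Lp Omega p : set (R -> R) := [set u | u \_ Omega \in Lfun mu p%:E].

Definition Lp_norm Omega p u : \bar R := 'N[mu]_(p%:E)[EFin \o u \_ Omega].

Definition is_weak_derivative Omega u v :=
  [/\ locally_integrable Omega u, locally_integrable Omega v &
      forall phi, test_function Omega phi ->
        \int[mu]_(x in Omega) (u x * derive1 phi x) =
        - \int[mu]_(x in Omega) (v x * phi x)].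

Definition W1p Omega p : set (R -> R) :=
  [set u | Lp Omega p u /\
           exists2 v, Lp Omega p v & is_weak_derivative Omega u v].

(* Norm in W^{1,p}(Omega) of a function u whose weak derivative is v. *)
Definition W1p_norm Omega p u v : \bar R :=
  ((Lp_norm Omega p u `^ p + Lp_norm Omega p v `^ p) `^ p^-1)%E.

(* v is the weak derivative of u, so that v - phi' is that of u - phi. *)
Definition W1p_0 Omega p : set (R -> R) :=
  [set u | W1p Omega p u /\
     exists v, [/\ Lp Omega p v, is_weak_derivative Omega u v &
       forall e : R, 0 < e -> exists2 phi, test_function Omega phi &
         (W1p_norm Omega p (u \- phi)%R (v \- derive1 phi)%R < e%:E)%E]].

Definition Gamma (s : R) : R :=
  \int[mu]_(t in `]0, +oo[) (t `^ (s - 1) * expR (- t)).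

Definition left_frac_derivative alpha phi x : R :=
  (Gamma (1 - alpha))^-1 *
  derive1 (fun z => \int[mu]_(y in `]-oo, z[) (phi y / (z - y) `^ alpha)) x.

Definition right_frac_derivative alpha phi x : R :=
  - (Gamma (1 - alpha))^-1 *
  derive1 (fun z => \int[mu]_(y in `]z, +oo[) (phi y / (y - z) `^ alpha)) x.

(* The left weak derivative is tested against right derivatives, and
   conversely. *)
Definition is_left_weak_frac_derivative alpha Omega u v :=
  [/\ Lp Omega 1 u, locally_integrable Omega v &
      forall phi, test_function Omega phi ->
        \int[mu]_(x in Omega) (v x * phi x) =
        \int[mu]_(x in Omega) (u x * right_frac_derivative alpha phi x)].

Definition is_right_weak_frac_derivative alpha Omega u v :=
  [/\ Lp Omega 1 u, locally_integrable Omega v &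
      forall phi, test_function Omega phi ->
        \int[mu]_(x in Omega) (v x * phi x) =
        \int[mu]_(x in Omega) (u x * left_frac_derivative alpha phi x)].

Definition left_Wap Omega alpha p : set (R -> R) :=
  [set u | Lp Omega p u /\
     exists2 v, Lp Omega p v & is_left_weak_frac_derivative alpha Omega u v].

Definition right_Wap Omega alpha p : set (R -> R) :=
  [set u | Lp Omega p u /\
     exists2 v, Lp Omega p v & is_right_weak_frac_derivative alpha Omega u v].

Definition Wap Omega alpha p : set (R -> R) :=
  left_Wap Omega alpha p `&` right_Wap Omega alpha p.

End fractional_sobolev.

(* Main.v *)
Require Import Defs.
From mathcomp Require Import all_boot all_order all_algebra.
From mathcomp Require Import all_classical all_reals all_analysis.
From mathcomp Require Import measurable_realfun ring lra.

Import Order.TTheory GRing.Theory Num.Theory.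
Import numFieldNormedType.Exports.

Local Open Scope classical_set_scope.
Local Open Scope ring_scope.

(* Let k be the kernel t^(-alpha) cut off to ]0, b - a[; it is integrable since
   alpha < 1.  On ]a, b[ the right fractional derivative of a test function phi
   is -1/Gamma(1 - alpha) times the convolution K phi' of phi' with the
   reflection of k, and (K phi)' = K phi'.  If v is the weak derivative of u,
   extended by 0, the left weak fractional derivative of u is 1/Gamma(1 - alpha)
   times the adjoint K^* v, which is in L^p by Young's inequality.  By Fubini,
   testing it against phi amounts to
     \int v (K phi) = - \int u (K phi)'.
   As K phi need not vanish at a, this fails for a general u in W^{1,p}; for u in
   W^{1,p}_0 it follows by approximating u by test functions.  Reflecting k gives
   the other sign. *)

Set Implicit Arguments.
Unset Strict Implicit.
Unset Printing Implicit Defensive.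

(* Replaces Hoelder's inequality: integrating it and choosing d bounds an
   L^1-norm by an L^p-norm, over any finite measure. *)
Lemma le_split_powR (R : realType) (p d z : R) : 1 <= p -> 0 < d -> 0 <= z ->
  z <= d + d `^ (1 - p) * z `^ p.
Proof.
move=> p1 d0 z0; have [zd|dz] := leP z d.
  by rewrite (le_trans zd)// lerDl mulr_ge0// powR_ge0.
have zgt0 : 0 < z by exact: lt_trans dz.
rewrite -[leLHS]add0r lerD ?(ltW d0)//.
rewrite -(@mulr_powRB1 _ z p) ?(lt_le_trans ltr01)// mulrCA.
rewrite -[leLHS]mulr1 ler_pM2l//.
have -> : 1 - p = - (p - 1) by rewrite opprB.
rewrite powRN ler_pdivlMl ?powR_gt0// mulr1.
by rewrite ge0_ler_powR ?subr_ge0// ?nnegrE ltW.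
Qed.

(** * Invariance of Lebesgue measure under translation and reflection *)

Section lebesgue_translation.
Context {R : realType}.
Local Notation mu := (@lebesgue_measure R).

(** Lebesgue measure is determined by its values on half-open intervals, and translation preserves
    their length. *)
Lemma lebesgue_measure_translation (c : R) (A : set R) : measurable A ->
  pushforward mu ((fun x => c + x) : _ -> measurableTypeR R) A = mu A.
Proof.
have mc : measurable_fun setT (fun x : R => c + x) by exact: measurable_funD.
move=> mA; apply/esym.
pose shift_c := (fun x => c + x) : _ -> measurableTypeR R.
apply: (@lebesgue_measure_unique R (pushforward mu shift_c)) => //= _ [[a b]] _ <-.
rewrite /pushforward /=.
have -> : (fun x => c + x) @^-1` `]a, b] = `](a - c), (b - c)]%classic.
  by apply/seteqP; split => x /=; rewrite !in_itv/= ltrBlDl lerBrDl.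
rewrite !lebesgue_measure_itv/= !lte_fin ltrD2r -!EFinD.
by congr (if _ then _ else _); congr EFin; ring.
Qed.

Lemma ge0_integral_translation (f : R -> \bar R) (c : R) : measurable_fun setT f ->
  (forall x, 0 <= f x)%E -> (\int[mu]_x f (c + x)%R = \int[mu]_x f x)%E.
Proof.
move=> mf f0.
have mc : measurable_fun setT (fun x : R => c + x) by exact: measurable_funD.
rewrite -[LHS](@ge0_integral_pushforward _ _ (measurableTypeR R)
  (measurableTypeR R) R _ mc mu setT f)//.
by apply: eq_measure_integral => //= A mA _; exact: lebesgue_measure_translation.
Qed.

(** The map is negation followed by translation by [c], and both preserve the measure. *)
Lemma ge0_integral_reflection (f : R -> \bar R) (c : R) : measurable_fun setT f ->
  (forall x, 0 <= f x)%E -> (\int[mu]_x f (c - x)%R = \int[mu]_x f x)%E.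
Proof.
move=> mf f0.
have mN : measurable_fun setT (-%R : R -> R) by exact: oppr_measurable.
have mc : measurable_fun setT (fun x : R => c + x) by exact: measurable_funD.
rewrite -(ge0_integral_translation c mf f0).

rewrite -[LHS](@ge0_integral_pushforward _ _ (measurableTypeR R)
  (measurableTypeR R) R _ mN mu setT (fun x => f (c + x)))//.
  by apply: eq_measure_integral => //= A mA _; exact: lebesgue_measureN.
exact: (measurableT_comp mf mc).
Qed.

(** Measurability suffices: the integral is the difference of those of the positive and negative
    parts, and each of these is invariant. *)
Lemma integral_translation (f : R -> \bar R) (c : R) : measurable_fun setT f ->
  (\int[mu]_x f (c + x)%R = \int[mu]_x f x)%E.
Proof.
move=> mf; rewrite integralE [RHS]integralE.
rewrite -(ge0_integral_translation c (measurable_funepos mf) (funepos_ge0 f)).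
rewrite -(ge0_integral_translation c (measurable_funeneg mf) (funeneg_ge0 f)).
by rewrite -/(f \o +%R c) funepos_comp funeneg_comp.
Qed.

End lebesgue_translation.

(** * Integrability of the power singularity at 0 *)

Section power_kernel.
Context {R : realType}.
Local Notation mu := (@lebesgue_measure R).

Lemma is_derive_shift_powR (a e t : R) : 0 < t + e -> a != 0 ->
  is_derive t 1 (fun x => (x + e) `^ a / a) ((t + e) `^ (a - 1)).
Proof.
move=> te a0.
have dt : is_derive t 1 (fun x : R => x + e) 1 by exact: is_derive_shift.
have dp := @is_derive1_comp R (@powR R ^~ a) (fun x => x + e) t _ _
  (is_derive1_powR a te) dt.
rewrite (_ : (fun x => _) = a^-1 *: ((@powR R ^~ a) \o (fun x => x + e))).
  by apply: is_derive_eq; rewrite /GRing.scale/= mulr1 mulKf.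
by apply/funext => x; rewrite /GRing.scale/= mulrC.
Qed.

(** The singularity at 0 keeps the fundamental theorem of calculus from applying directly on [0, T].
    The integrand is therefore shifted by [e n], which tends to 0; the shifted integrals are bounded
    uniformly in n, and monotone convergence passes to the limit. *)
Lemma integrable_powR_oo (alpha T : R) : alpha < 1 ->
  0 <= alpha -> 0 < T -> mu.-integrable `]0, T[ (fun t => (t `^ (- alpha))%:E).
Proof.
move=> alpha1 alpha0 T0.
have b0 : 0 < 1 - alpha by rewrite subr_gt0.
have mD : measurable (`]0, T[ : set R) by exact: measurable_itv.
have mf (e : R) : measurable_fun setT (fun t : R => (t + e) `^ (- alpha)).
  by apply: (measurableT_comp (measurable_powR _)) => //; exact: measurable_funD.
pose e n : R := n.+1%:R^-1.
have e0 n : 0 < e n by rewrite invr_gt0 ltr0n.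
pose F n (x : R) := (x + e n) `^ (1 - alpha) / (1 - alpha).
have dF n (x : R) : 0 <= x -> is_derive x 1 (F n) ((x + e n) `^ (- alpha)).
  move=> x0; rewrite (_ : - alpha = (1 - alpha) - 1); last by rewrite addrAC subrr add0r.
  apply: is_derive_shift_powR; last by rewrite gt_eqF.
  by rewrite ltr_wpDl.
have cF n (x : R) : 0 <= x -> {for x, continuous (F n)}.
  by move=> x0; apply/differentiable_continuous/derivable1_diffP; have [] := dF n x x0.
have cp (x : R) : 0 < x -> {for x, continuous (fun y : R => y `^ (- alpha))}.
  move=> x0; apply/differentiable_continuous/derivable1_diffP.
  by have [] := is_derive1_powR (- alpha) x0.
(* The bound does not depend on n because [e n] is at most 1. The closed interval is the one on
   which the antiderivative [F n] is evaluated. *)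
have leC n : (\int[mu]_(t in `]0%R, T[) ((t + e n) `^ (- alpha))%:E <=
    ((T + 1) `^ (1 - alpha) / (1 - alpha))%:E)%E.
  apply: (@le_trans _ _ (\int[mu]_(t in `[0%R, T]) ((t + e n) `^ (- alpha))%:E)%E).
    apply: ge0_subset_integral => //.
    - by apply/measurable_EFinP; exact: (measurable_funTS (mf _)).
    - by move=> x _; rewrite lee_fin powR_ge0.
    - exact: subset_itv_oo_cc.
  rewrite (@continuous_FTC2 _ _ (F n))//.
  - rewrite -EFinB lee_fin /F add0r -mulrBl ler_pM2r ?invr_gt0//.
    rewrite lerBlDr; apply: ler_wpDr; first exact: powR_ge0.
    rewrite ge0_ler_powR ?(ltW b0) ?nnegrE ?addr_ge0 ?(ltW T0) ?(ltW (e0 _))//.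
    by rewrite lerD2l invf_le1 ?ler1n ?ltr0n.
  - apply: continuous_in_subspaceT => x; rewrite inE/= in_itv/= => /andP[x0 _].
    apply: (@continuous_comp _ _ _ (fun y : R => y + e n) (fun y : R => y `^ (- alpha))).
      by apply: continuousD => //; exact: cst_continuous.
    by apply: cp; rewrite ltr_wpDl.
  - split.
    + by move=> x; rewrite in_itv/= => /andP[x0 _]; have [] := dF n x (ltW x0).
    + by apply: cvg_at_right_filter; exact: cF.
    + by apply: cvg_at_left_filter; apply: cF; exact: ltW.
  - move=> x; rewrite in_itv/= => /andP[x0 _].
    by rewrite derive1E; have [_ ->] := dF n x (ltW x0).
have mt : measurable_fun (`]0, T[ : set R) (fun t : R => (t `^ (- alpha))%:E).
  by apply/measurable_EFinP; apply: measurable_funTS; exact: measurable_powR.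
apply/integrableP; split => //.
under eq_integral do rewrite gee0_abs ?lee_fin ?powR_ge0//.
apply: (@le_lt_trans _ _ ((T + 1) `^ (1 - alpha) / (1 - alpha))%:E); last exact: ltry.
(* The shift decreases with n and the exponent is at most 0, so the integrands increase. *)
have nd_f (t : R) : 0 < t ->
    {homo (fun n => ((t + e n) `^ (- alpha))%:E) : n m / (n <= m)%N >-> (n <= m)%E}.
  move=> t0 n m nm; rewrite lee_fin !powRN lef_pV2 ?posrE ?powR_gt0 ?addr_gt0//.
  rewrite ge0_ler_powR ?nnegrE ?addr_ge0 ?(ltW t0) ?(ltW (e0 _))//.
  by rewrite lerD2l lef_pV2 ?posrE ?ltr0n// ler_nat.
have /= cvgl : (\int[mu]_(x in `]0%R, T[) ((x + e n) `^ (- alpha))%:E)%E @[n --> \oo] -->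
    (\int[mu]_(x in `]0%R, T[) limn (fun n => ((x + e n) `^ (- alpha))%:E))%E.
  apply: (@cvg_monotone_convergence _ (measurableTypeR R) R mu `]0, T[ mD
    (fun n t => ((t + e n) `^ (- alpha))%:E)).
  - by move=> n; apply/measurable_EFinP; exact: (measurable_funTS (mf _)).
  - by move=> n x _; rewrite lee_fin powR_ge0.
  - by move=> x; rewrite /= in_itv/= => /andP[x0 _]; exact: nd_f.
rewrite (_ : (\int[mu]_(x in `]0%R, T[) (x `^ (- alpha))%:E)%E =
    (\int[mu]_(x in `]0%R, T[) limn (fun n => ((x + e n) `^ (- alpha))%:E))%E).
  rewrite -(cvg_lim _ cvgl)//.
  apply: lime_le; last by apply: nearW => n; exact: leC.
  by apply/cvg_ex; eexists; exact: cvgl.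
apply: eq_integral => x; rewrite inE/= in_itv/= => /andP[x0 _].
apply/esym/cvg_lim => //; apply: cvg_EFin; first exact: nearW.
rewrite /comp/=.
have : (x + e n) @[n --> \oo] --> x.
  rewrite -[X in _ --> X]addr0; apply: cvgD; first exact: cvg_cst.
  exact: cvg_harmonic.
exact: (continuous_cvg _ (cp x x0)).
Qed.

End power_kernel.

(** * Convolution operators with an integrable kernel: adjoint and Young's inequality *)

Section kernel_operator.
Context {R : realType}.
Local Notation mu := (@lebesgue_measure R).
Local Notation R2 := (measurableTypeR R * measurableTypeR R)%type.
Implicit Types (k f g : R -> R).

(** This is the convolution of f with the reflection of k. The argument is written [- x + y] to
    match the form [c + x] of the translation lemmas. *)
Definition kernel_op k f (x : R) : R := \int[mu]_y (k (- x + y) * f y).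

Lemma integrable_reflection k : mu.-integrable setT (EFin \o k) ->
  mu.-integrable setT (EFin \o (k \o -%R)).
Proof.
move=> /integrableP[mk ik].
have mN : measurable_fun setT (-%R : R -> R) by exact: oppr_measurable.
have mk' : measurable_fun setT (EFin \o (k \o -%R)) by exact: (measurableT_comp mk mN).
apply/integrableP; split => //.
have ma : measurable_fun setT (fun x => `|(EFin \o k) x|%E) by exact: measurableT_comp.
rewrite -(ge0_integral_reflection 0 ma) in ik => //.
by move: ik; under eq_integral do rewrite sub0r.
Qed.

Lemma measurable_kernel2 k : measurable_fun setT k ->
  measurable_fun setT (fun z : R2 => k (- z.1 + z.2)).
Proof.
move=> mk; apply: (measurableT_comp mk) => //.
apply: measurable_funD; last exact: measurable_snd.
exact: (measurableT_comp (@oppr_measurable R _) measurable_fst).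
Qed.

(** By Tonelli the integral in x can be taken first; for fixed y, reflection turns it into the total
    mass of k, independent of y. *)
Lemma ge0_integral_kernel_op k (h : R -> \bar R) : measurable_fun setT k ->
  (forall x, 0 <= k x) -> measurable_fun setT h -> (forall x, 0 <= h x)%E ->
  (\int[mu]_x \int[mu]_y ((k (- x + y))%:E * h y) =
  (\int[mu]_t (k t)%:E) * \int[mu]_y h y)%E.
Proof.
move=> mk k0 mh h0.
have mkh : measurable_fun setT (fun z : R2 =>
     ((k (- z.1 + z.2))%:E * h z.2)%E).
  apply: emeasurable_funM; first by apply/measurable_EFinP; exact: measurable_kernel2.
  exact: (measurableT_comp mh measurable_snd).
rewrite (@fubini_tonelli _ _ (measurableTypeR R) (measurableTypeR R) R mu mu _ mkh)/=.
  2: by move=> z; rewrite mule_ge0// lee_fin.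
have mk2 (y : R) : measurable_fun setT (fun x : R => (k (- x + y))%:E).
  apply/measurable_EFinP.
  exact: (measurableT_comp (measurable_kernel2 mk) (measurable_pair2 y)).
have inner (y : R) :
    (\int[mu]_x ((k (- x + y))%:E * h y) = (\int[mu]_t (k t)%:E) * h y)%E.
  rewrite ge0_integralZr//; [|exact: mk2|by move=> x _; rewrite lee_fin].
  rewrite -(ge0_integral_reflection y (f := EFin \o k)).
  2: exact/measurable_EFinP.
  2: by move=> x; rewrite lee_fin.
  by under eq_integral do rewrite addrC.
under eq_integral do rewrite inner.
rewrite ge0_integralZl//.
by apply: integral_ge0 => t _; rewrite lee_fin.
Qed.

(** Taking absolute values leaves the product of the integrals of k and |f|, which is finite. This
    licenses the later uses of Fubini. *)
Lemma integrable_kernel k f : (forall x, 0 <= k x) ->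
  mu.-integrable setT (EFin \o k) -> mu.-integrable setT (EFin \o f) ->
  (mu \x mu)%E.-integrable setT
    (fun z : R2 => (k (- z.1 + z.2) * f z.2)%:E).
Proof.
move=> k0 ik fi.
have /integrableP[/measurable_EFinP mk iky] := ik.
have /integrableP[/measurable_EFinP mf ify] := fi.
apply/integrable12ltyP.
  apply/measurable_EFinP; apply: measurable_funM; first exact: measurable_kernel2.
  exact: (measurableT_comp mf measurable_snd).
rewrite /=.
under eq_integral => x _.
  under eq_integral do rewrite normrM EFinM (ger0_norm (k0 _)).
  over.
rewrite (ge0_integral_kernel_op mk k0 (h := fun y => `|f y|%:E))//; last first.
  by apply/measurable_EFinP; exact: measurableT_comp.
rewrite lte_mul_pinfty//.
- by apply: integral_ge0 => t _; rewrite lee_fin.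
- by rewrite integrable_fin_num.
Qed.

Lemma integrable_kernel_bounded k f g (C : R) : (forall x, 0 <= k x) ->
  mu.-integrable setT (EFin \o k) -> mu.-integrable setT (EFin \o f) ->
  measurable_fun setT g -> (forall x, `|g x| <= C) ->
  (mu \x mu)%E.-integrable setT
    (fun z : R2 => (g z.1 * (k (- z.1 + z.2) * f z.2))%:E).
Proof.
move=> k0 ik fi mg gC.
have ikf := integrable_kernel k0 ik fi.
apply: (le_integrable measurableT _ _ (integrableZl measurableT C ikf)) => /=.
  apply/measurable_EFinP; apply: measurable_funM => //.
    exact: (measurableT_comp mg measurable_fst).
  by have /integrableP[/measurable_EFinP] := ikf.
move=> z _; rewrite lee_fin normrM [leRHS]normrM ler_wpM2r//.
by rewrite (le_trans (gC _))// ler_norm.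
Qed.

Lemma integrable_translation k (c : R) : mu.-integrable setT (EFin \o k) ->
  mu.-integrable setT (fun x => (k (c + x)%R)%:E).
Proof.
move=> /integrableP[mk ik].
have mc : measurable_fun setT (fun x : R => c + x) by exact: measurable_funD.
apply/integrableP; split; first exact: (measurableT_comp mk mc).
have ma : measurable_fun setT (fun x => `|(EFin \o k) x|%E) by exact: measurableT_comp.
by rewrite -(ge0_integral_translation c ma) in ik.
Qed.

Lemma integrable_reflection_translation k (c : R) : mu.-integrable setT (EFin \o k) ->
  mu.-integrable setT (fun x => (k (- x + c)%R)%:E).
Proof.
move=> /integrable_reflection/(@integrable_translation _ (- c)).
by apply: eq_integrable => // x _ /=; rewrite opprD opprK addrC.
Qed.

Lemma integrableM_bounded k g (C : R) : mu.-integrable setT (EFin \o k) ->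
  measurable_fun setT g -> (forall x, `|g x| <= C) ->
  mu.-integrable setT (fun x => (k x * g x)%:E).
Proof.
move=> ik mg gC.
have /integrableP[/measurable_EFinP mk _] := ik.
apply: (le_integrable measurableT _ _ (integrableZl measurableT C ik)) => /=.
  by apply/measurable_EFinP; exact: measurable_funM.
move=> z _; rewrite lee_fin normrM [leRHS]normrM mulrC ler_wpM2r//.
by rewrite (le_trans (gC _))// ler_norm.
Qed.

Section integrable_kernel.
Variable k : R -> R.
Hypotheses (k0 : forall x, 0 <= k x) (ik : mu.-integrable setT (EFin \o k)).

Let mk : measurable_fun setT k.
Proof. by have /integrableP[/measurable_EFinP] := ik. Qed.

Lemma measurable_kernel_op f : mu.-integrable setT (EFin \o f) ->
  measurable_fun setT (kernel_op k f).
Proof.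
move=> fi.
have /measurable_fubini_F mF := integrable_kernel k0 ik fi.
exact: (measurableT_comp (@fine_measurable R _ measurableT) mF).
Qed.

(** This is Fubini for g(x) k(y - x) f(y): read from y, the kernel appears reflected. The care lies
    in passing between real-valued and extended integrals. *)
Lemma kernel_op_adjoint f g (C : R) : mu.-integrable setT (EFin \o f) ->
  measurable_fun setT g -> (forall x, `|g x| <= C) ->
  \int[mu]_x (g x * kernel_op k f x) =
  \int[mu]_y (f y * kernel_op (k \o -%R) g y).
Proof.
move=> fi mg gC.
have ig := integrable_kernel_bounded k0 ik fi mg gC.
have i1 := integrable_kernel k0 ik fi.
have /= F := Fubini ig.
rewrite /Rintegral; congr fine.
transitivity (\int[mu]_x \int[mu]_y (g x * (k (- x + y)%R * f y))%:E)%E.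
  apply: ae_eq_integral => //.
  - apply/measurable_EFinP; apply: measurable_funM => //.
    exact: measurable_kernel_op.
  - exact: (measurable_fubini_F ig).
  (* As f is only integrable, the integral defining [kernel_op k f x] converges for almost every x,
     which is enough here. *)
  - have := ae_integrable1 i1; apply: filterS => x /= + _.
    move=> ix; under [RHS]eq_integral do rewrite EFinM.
    rewrite integralZl// EFinM; congr (_ * _)%E.
    by rewrite /kernel_op /Rintegral fineK// integrable_fin_num.
rewrite F; apply: eq_integral => y _.
(* As g is bounded, the inner integral on this side converges for every y. *)
have iy := integrableM_bounded (integrable_reflection_translation y ik) mg gC.
have ky (x : R) : (k \o -%R) (- y + x) * g x = k (- x + y) * g x.
  by rewrite /= opprD opprK addrC.
have {}iy : mu.-integrable setT (fun x => ((k \o -%R) (- y + x)%R * g x)%:E).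
  by apply: eq_integrable iy => // x _; rewrite ky.
rewrite EFinM /kernel_op /Rintegral fineK; last exact: integrable_fin_num.
rewrite -integralZl//; apply: eq_integral => x _.
by rewrite -EFinM ky; congr EFin; ring.
Qed.

(** This is Jensen's inequality, up to the factor 2, for the measure k(y - x) dy of mass at most N.
    The factor comes from using [le_split_powR] in place of convexity. *)
Lemma kernel_op_powR_le f (p x N : R) : 1 <= p -> 0 < N ->
  (\int[mu]_t (k t)%:E <= N%:E)%E ->
  mu.-integrable setT (EFin \o f) ->
  (N%:E * ((`|kernel_op k f x| / (2 * N)) `^ p)%:E <=
   \int[mu]_y ((k (- x + y)%R)%:E * (`|f y| `^ p)%:E))%E.
Proof.
move=> p1 N0 kN fi.
have p0 : 0 < p by exact: lt_le_trans p1.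
have /integrableP[/measurable_EFinP mf _] := fi.
have ix := integrable_translation (- x) ik.
have mkf : measurable_fun setT (fun y => k (- x + y) * `|f y| `^ p).
  apply: measurable_funM; first by have /integrableP[/measurable_EFinP] := ix.
  by apply: (measurableT_comp (measurable_powR _)); exact: measurableT_comp.
pose A := (\int[mu]_y ((k (- x + y)%R)%:E * (`|f y| `^ p)%:E))%E.
have A0 : (0 <= A)%E.
  by apply: integral_ge0 => y _; rewrite mule_ge0// lee_fin// powR_ge0.
(* The zero value is set aside since the splitting level d below must be positive; an infinite
   right-hand side is trivial. *)
have [->|K0] := eqVneq (kernel_op k f x) 0.
  by rewrite normr0 mul0r powR0 ?gt_eqF// mule0.
rewrite -[leRHS]/A; move: A0; case Ea : A => [a| |]; last 2 first.
- by move=> _; rewrite leey.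
- by [].
move=> _.
have ikf : mu.-integrable setT (fun y => (k (- x + y)%R * `|f y| `^ p)%:E).
  apply/integrableP; split; first exact/measurable_EFinP.
  under eq_integral do rewrite gee0_abs ?lee_fin ?mulr_ge0 ?powR_ge0// EFinM.
  by rewrite -/A Ea ltry.
(* With this d the term d N of the splitting is exactly m / 2, so it can be absorbed into the
   left-hand side. What remains is d N at most d^(1 - p) a, that is, N d^p at most a. *)
set m := `|_|; pose d := m / (2 * N).
have N20 : 0 < 2 * N by rewrite mulr_gt0.
have m0 : 0 < m by rewrite normr_gt0.
have d0 : 0 < d by rewrite divr_gt0.
pose kfp y := d * k (- x + y) + d `^ (1 - p) * (k (- x + y) * `|f y| `^ p).
have le_kf (y : R) : `|k (- x + y) * f y| <= kfp y.
  rewrite /kfp normrM (ger0_norm (k0 _)) [d * _]mulrC [d `^ _ * _]mulrCA -mulrDr ler_wpM2l//.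
  exact: le_split_powR.
have idk : mu.-integrable setT (fun y => (d * k (- x + y)%R)%:E).
  exact: (integrableZl measurableT d ix).
have idkf : mu.-integrable setT
    (fun y => (d `^ (1 - p) * (k (- x + y)%R * `|f y| `^ p))%:E).
  exact: (integrableZl measurableT _ ikf).
have isum : mu.-integrable setT (EFin \o kfp).
  exact: (integrableD measurableT idk idkf).
have ikx : mu.-integrable setT (fun y => (k (- x + y)%R * f y)%:E).
  apply: (le_integrable measurableT _ _ isum).
    apply/measurable_EFinP; apply: measurable_funM => //.
    by have /integrableP[/measurable_EFinP] := ix.
  by move=> y _; rewrite lee_fin (le_trans (le_kf y))// ler_norm.
have : m <= d * N + d `^ (1 - p) * a.
  rewrite /m /kernel_op; apply: (le_trans (le_normr_Rintegral measurableT ikx)).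
  apply: (@le_trans _ _ (\int[mu]_y kfp y)).
    by apply: le_Rintegral => //; exact: (integrable_abse ikx).
  rewrite /kfp RintegralD// !RintegralZl// lerD//.
  - rewrite ler_wpM2l ?(ltW d0)// -lee_fin /Rintegral.
    rewrite fineK; last exact: integrable_fin_num.
    rewrite (ge0_integral_translation (- x) (f := EFin \o k))//.
    exact/measurable_EFinP.
  - rewrite ler_wpM2l ?powR_ge0// /Rintegral.
    by under eq_integral do rewrite EFinM; rewrite -/A Ea.
have mE : m = d * N + d * N by rewrite /d; field; rewrite gt_eqF.
have Ep : 1 - p = - (p - 1) by rewrite opprB.
rewrite {1}mE lerD2l Ep powRN ler_pdivlMl ?powR_gt0//.
rewrite -EFinM lee_fin; apply: le_trans.
by rewrite -/d mulrA [_ * d]mulrC mulr_powRB1 ?(ltW d0)// mulrC.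
Qed.

(** Young's inequality in qualitative form: the pointwise bound is integrated in x, and Tonelli
    gives the product of the integrals of k and |f|^p. *)
Lemma integrable_kernel_op_powR f (p : R) : 1 <= p ->
  mu.-integrable setT (EFin \o f) ->
  mu.-integrable setT (fun x => (`|f x| `^ p)%:E) ->
  mu.-integrable setT (fun x => (`|kernel_op k f x| `^ p)%:E).
Proof.
move=> p1 fi fpi.
have p0 : 0 < p by exact: lt_le_trans p1.
have /integrableP[mfp fpy] := fpi.
have mK : measurable_fun setT (kernel_op k f) by exact: measurable_kernel_op.
(* Adding 1 keeps N positive even when k vanishes almost everywhere. *)
pose N := fine (\int[mu]_t (k t)%:E)%E + 1.
have Ik0 : (0 <= \int[mu]_t (k t)%:E)%E.
  by apply: integral_ge0 => t _; rewrite lee_fin.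
have N0 : 0 < N by rewrite ltr_wpDl// fine_ge0.
have kN : (\int[mu]_t (k t)%:E <= N%:E)%E.
  by rewrite EFinD fineK ?leeDl// integrable_fin_num.
apply/integrableP; split.
  apply/measurable_EFinP; apply: (measurableT_comp (measurable_powR _)) => //.
  exact: measurableT_comp.
(* This constant results from solving the pointwise bound for |K f(x)|^p. *)
pose D := (2 * N) `^ p * N^-1.
have D0 : 0 <= D by rewrite mulr_ge0// ?powR_ge0// invr_ge0 ltW.
pose A x := (\int[mu]_y ((k (- x + y)%R)%:E * (`|f y| `^ p)%:E))%E.
have mkf : measurable_fun setT (fun z : R2 =>
    ((k (- z.1 + z.2))%:E * (`|f z.2| `^ p)%:E)%E).
  apply: emeasurable_funM; first by apply/measurable_EFinP; exact: measurable_kernel2.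
  exact: (measurableT_comp mfp measurable_snd).
have mA : measurable_fun setT A.
  apply: (measurable_fun_fubini_tonelli_F (m2 := mu) _ mkf) => z.
  by rewrite mule_ge0// lee_fin// powR_ge0.
have A0 x : (0 <= A x)%E.
  by apply: integral_ge0 => y _; rewrite mule_ge0// lee_fin// powR_ge0.
have leA x : ((`|kernel_op k f x| `^ p)%:E <= D%:E * A x)%E.
  have N20 : 0 < 2 * N by rewrite mulr_gt0.
  apply: le_trans (lee_wpmul2l _ (kernel_op_powR_le x p1 N0 kN fi)).
  2: by rewrite lee_fin.
  rewrite -!EFinM lee_fin mulrA mulfVK ?gt_eqF// -powRM ?divr_ge0// ?(ltW N20)//.
  by rewrite mulrCA divff ?mulr1// gt_eqF.
apply: (@le_lt_trans _ _ (\int[mu]_x (D%:E * A x))%E).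
  apply: ge0_le_integral => //.
  - apply: measurableT_comp => //; apply/measurable_EFinP.
    by apply: (measurableT_comp (measurable_powR _)); exact: measurableT_comp.
  - exact: measurable_funeM.
  - by move=> x _; rewrite gee0_abs ?lee_fin ?powR_ge0//.
rewrite ge0_integralZl//.
rewrite (ge0_integral_kernel_op mk k0 mfp)//.
have Ikp : (\int[mu]_t (k t)%:E * \int[mu]_y (`|f y| `^ p)%:E \is a fin_num)%E.
  by rewrite fin_numM// integrable_fin_num.
by rewrite lte_mul_pinfty// ltey_eq Ikp.
Qed.

End integrable_kernel.
End kernel_operator.

(** * Boundedness, continuity and differentiation of the convolution of a regular function *)

Section kernel_op_smooth.
Context {R : realType}.
Local Notation mu := (@lebesgue_measure R).
Variable k : R -> R.
Hypotheses (k0 : forall x, 0 <= k x) (ik : mu.-integrable setT (EFin \o k)).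
Implicit Types g : R -> R.

Let mk : measurable_fun setT k.
Proof. by have /integrableP[/measurable_EFinP] := ik. Qed.

(** The change of variable moves x from the kernel, which may be singular, into g. Continuity and
    differentiability in x then come from g alone. *)
Lemma kernel_opE g x : measurable_fun setT g ->
  kernel_op k g x = \int[mu]_t (k t * g (x + t)%R).
Proof.
move=> mg; rewrite /kernel_op /Rintegral; congr fine.
rewrite -(@integral_translation R (fun y => (k (- x + y) * g y)%:E) x).
  by apply: eq_integral => t _; rewrite addKr.
apply/measurable_EFinP; apply: measurable_funM => //.
apply: (measurableT_comp mk) => //; exact: measurable_funD.
Qed.

Let integrable_shift g (C x : R) : measurable_fun setT g ->
  (forall x, `|g x| <= C) -> mu.-integrable setT (fun t => (k t * g (x + t)%R)%:E).
Proof.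
move=> mg gC; apply: (integrableM_bounded (C := C) ik) => //.
apply: (measurableT_comp mg) => //; exact: measurable_funD.
Qed.

Let integrable_bound (C : R) : mu.-integrable setT (EFin \o (fun t => C * k t)).
Proof. exact: (integrableZl measurableT C ik). Qed.

Lemma kernel_op_bounded g (C : R) : measurable_fun setT g ->
  (forall x, `|g x| <= C) -> forall x, `|kernel_op k g x| <= C * \int[mu]_t k t.
Proof.
move=> mg gC x; rewrite kernel_opE//.
apply: (le_trans (le_normr_Rintegral measurableT (integrable_shift x mg gC))).
rewrite -RintegralZl//; apply: le_Rintegral => //.
- exact: (integrable_abse (integrable_shift x mg gC)).
- by move=> t _; rewrite normrM (ger0_norm (k0 _)) mulrC ler_wpM2r.
Qed.

Lemma continuous_kernel_op g (C : R) : continuous g ->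
  (forall x, `|g x| <= C) -> continuous (kernel_op k g).
Proof.
move=> cg gC x.
have mg : measurable_fun setT g by exact: continuous_measurable_fun.
rewrite (_ : kernel_op k g = fun x => \int[mu]_t (k t * g (x + t)%R)); last first.
  by apply/funext => y; exact: kernel_opE.
apply: (@continuity_under_integral R _ _ mu (fun x t => k t * g (x + t)) setT
  measurableT (x - 1) (x + 1) _ _ (fun t => C * k t)) => //.
- by move=> y _; exact: integrable_shift.
- apply: nearW => t _ y _ /=.
  apply: continuousM; first exact: cst_continuous.
  apply: (@continuous_comp _ _ _ (fun y : R => y + t) g); last exact: cg.
  by apply: continuousD => //; exact: cst_continuous.
- by move=> y _; apply: nearW => t _; rewrite normrM (ger0_norm (k0 _)) mulrC ler_wpM2r.
- by rewrite inE/= in_itv/=; apply/andP; split; lra.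
Qed.

(** After [kernel_opE] the x-derivative of the integrand is k(t) g'(x + t), dominated by the
    integrable function C' k(t) uniformly in x, so differentiation under the integral applies. *)
Lemma is_derive_kernel_op g (C C' x : R) : (forall x, derivable g x 1) ->
  (forall x, `|g x| <= C) -> continuous (derive1 g) ->
  (forall x, `|derive1 g x| <= C') ->
  is_derive x 1 (kernel_op k g) (kernel_op k (derive1 g) x).
Proof.
move=> dg gC cg' gC'.
have cg : continuous g by move=> y; exact/differentiable_continuous/derivable1_diffP.
have mg : measurable_fun setT g by exact: continuous_measurable_fun.
have mg' : measurable_fun setT (derive1 g) by exact: continuous_measurable_fun.
rewrite (_ : kernel_op k g = fun x => \int[mu]_t (k t * g (x + t)%R)); last first.
  by apply/funext => y; exact: kernel_opE.
have df (y t : R) : is_derive y 1 (fun y => k t * g (y + t)) (k t * derive1 g (y + t)).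
  have ds : is_derive y 1 (fun x : R => x + t) 1 by exact: is_derive_shift.
  have dg' : is_derive (y + t) 1 g (derive1 g (y + t)).
    by rewrite derive1E; exact: derivableP.
  have dc := @is_derive1_comp R g (fun x => x + t) y _ _ dg' ds.
  by have := is_deriveZ (k t) dc; rewrite mulr1.
pose F y t := k t * g (y + t); pose I : set R := `]x - 1, x + 1[%classic.
have p1E (y t : R) : partial1of2 F y t = k t * derive1 g (y + t).
  by rewrite partial1of2E; have [_ ->] := df y t.
have C'0 : 0 <= C' by exact: le_trans (gC' 0).
have Ix : I x by rewrite /I/= in_itv/=; apply/andP; split; lra.
have intF y : I y -> mu.-integrable setT (EFin \o F y).
  by move=> _; exact: integrable_shift.
have derF y t : I y -> setT t -> derivable (F ^~ t) y 1.
  by move=> _ _; have [] := df y t.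
have C'k0 (t : R) : 0 <= C' * k t by rewrite mulr_ge0.
have F_ub y t : I y -> setT t -> `|partial1of2 F y t| <= C' * k t.
  by move=> _ _; rewrite p1E normrM (ger0_norm (k0 _)) mulrC ler_wpM2r.
apply: DeriveDef.
  exact: (@derivable_under_integral R _ _ mu F setT measurableT x (x - 1) (x + 1)
    Ix intF derF _ C'k0 (integrable_bound C') F_ub).
rewrite -derive1E.
rewrite (@differentiation_under_integral R _ _ mu F setT measurableT x (x - 1) (x + 1)
  Ix intF derF _ C'k0 (integrable_bound C') F_ub).
rewrite kernel_opE//; apply: eq_Rintegral => t _; exact: p1E.
Qed.

End kernel_op_smooth.

(** * Test functions on an interval and integration by parts *)

Section test_functions.
Context {R : realType}.
Local Notation mu := (@lebesgue_measure R).
Variables (a b : R) (phi : R -> R).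
Hypotheses (ab : a < b) (tphi : test_function `]a, b[ phi).

Lemma derivable_test_function x : derivable phi x 1.
Proof. by have [/(_ 0%N)] := tphi. Qed.

Lemma continuous_test_function : continuous phi.
Proof.
move=> x; apply/differentiable_continuous/derivable1_diffP.
exact: derivable_test_function.
Qed.

Lemma continuous_derive_test_function : continuous (derive1 phi).
Proof.
move=> x; apply/differentiable_continuous/derivable1_diffP.
by have [/(_ 1%N)] := tphi.
Qed.

Lemma test_function_eq0 x : x \notin `]a, b[ -> phi x = 0.
Proof.
move=> xab; apply/eqP; apply: contraNT xab => x0.
by have [_ _] := tphi; apply; exact: subset_closure.
Qed.

(** A point outside the interval, possibly an end point, lies in the open complement of the support,
    so [phi] vanishes on a whole neighbourhood of it. *)
Lemma derive_test_function_eq0 x : x \notin `]a, b[ -> derive1 phi x = 0.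
Proof.
move=> xab; have [_ _ sub] := tphi.
have xN : (~` closure [set x | phi x != 0]) x by move=> /sub/=; apply/negP.
rewrite derive1E (@near_eq_derive _ _ _ _ (cst 0))// ?derive_cst//.
have oN : open (~` closure [set x | phi x != 0]).
  exact/closed_openC/closed_closure.
apply: filterS (open_nbhs_nbhs (conj oN xN)) => y yN.
by apply/eqP; apply: contra_notT yN => y0; exact: subset_closure.
Qed.

Lemma continuous_eq0_bounded (g : R -> R) : continuous g ->
  (forall x, x \notin `]a, b[ -> g x = 0) -> exists C, forall x, `|g x| <= C.
Proof.
move=> cg g0.
have [c _ gc] : exists2 c, c \in `[a, b] & forall t, t \in `[a, b] -> `|g t| <= `|g c|.
  apply: (@EVT_max R (fun x => `|g x|)); first exact: ltW.
  apply: continuous_subspaceT => x.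
  by apply: continuous_comp; [exact: cg|exact: norm_continuous].
exists `|g c| => x; have [/subset_itv_oo_cc/gc//|/g0 ->] := boolP (x \in `]a, b[).
by rewrite normr0.
Qed.

(** The boundary terms vanish because [phi] is zero at both end points; G itself may be nonzero
    there. *)
Lemma test_function_by_parts (G g : R -> R) :
  (forall x : R, is_derive x 1 G (g x)) -> continuous g ->
  \int[mu]_(x in `]a, b[) (derive1 phi x * G x) =
  - \int[mu]_(x in `]a, b[) (phi x * g x).
Proof.
move=> dG cg.
have cG : continuous G.
  by move=> x; apply/differentiable_continuous/derivable1_diffP; have [] := dG x.
(* Integration by parts is stated on [a, b]; the factor vanishing off ]a, b[ makes the integrals
   over the open and the closed interval equal. *)
have cc (f h : R -> R) : (forall x, x \notin `]a, b[ -> f x = 0) ->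
    \int[mu]_(x in `]a, b[) (f x * h x) = \int[mu]_(x in `[a, b]) (f x * h x).
  move=> f0; rewrite Rintegral_mkcond [RHS]Rintegral_mkcond; congr Rintegral.
  apply/funext => x; rewrite !patchE !mem_setE.
  case: ifPn => [/subset_itv_oo_cc ->//|/f0 ->].
  by rewrite mul0r; case: ifP.
rewrite (cc _ _ derive_test_function_eq0) (cc _ _ test_function_eq0).
have DLR (f : R -> R) : (forall x, derivable f x 1) -> derivable_oo_LRcontinuous f a b.
  move=> df; have cf : continuous f.
    by move=> x; apply/differentiable_continuous/derivable1_diffP.
  split => [x _ //||]; [apply: cvg_at_right_filter|apply: cvg_at_left_filter];
    exact: cf.
have := @Rintegration_by_parts R phi G (derive1 phi) g a b ab.
rewrite (@test_function_eq0 a) ?in_itv/= ?ltxx//.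
rewrite (@test_function_eq0 b) ?in_itv/= ?ltxx ?andbF//.
rewrite !mul0r subrr sub0r => ->; first by rewrite opprK.
- exact/continuous_subspaceT/continuous_derive_test_function.
- by apply: DLR => x; exact: derivable_test_function.
- by [].
- exact: continuous_subspaceT.
- by apply: DLR => x; have [] := dG x.
- by move=> x _; rewrite derive1E; have [_ ->] := dG x.
Qed.

End test_functions.

(** * Estimates in L^p on a bounded interval *)

Section Lp_spaces.
Context {R : realType}.
Local Notation mu := (@lebesgue_measure R).
Variables (a b p : R).
Hypotheses (ab : a < b) (p1 : 1 <= p).
Local Notation Omega := (`]a, b[%classic : set R).

Let p0 : 0 < p. Proof. exact: lt_le_trans p1. Qed.

Let mO : measurable (Omega : set (measurableTypeR R)). Proof. exact: measurable_itv. Qed.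

Lemma Lp_measurable (u : R -> R) : Lp Omega p u -> measurable_fun setT (u \_ Omega).
Proof. by move=> /sub_Lfun_mfun/set_mem. Qed.

Lemma Lp_integrable_powR (u : R -> R) : Lp Omega p u ->
  mu.-integrable setT (fun x => (`|(u \_ Omega) x| `^ p)%:E).
Proof. by move=> Lu; exact: Lfun_integrable. Qed.

Lemma Lp_intro (w : R -> R) : measurable_fun setT w ->
  mu.-integrable setT (fun x => (`|w x| `^ p)%:E) -> Lp Omega p w.
Proof.
move=> mw iw; have mwO : measurable_fun setT (w \_ Omega).
  by apply/(measurable_restrictT _ mO); exact: measurable_funTS.
apply/andP; split; rewrite inE//= /finite_norm unlock poweR_lty//.
have /integrableP[_] := iw; apply: le_lt_trans.
have mp (f : R -> R) : measurable_fun setT f ->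
    measurable_fun setT (fun x => (`|f x| `^ p)%:E).
  move=> mf; apply/measurable_EFinP.
  by apply: (measurableT_comp (measurable_powR _)); exact: measurableT_comp.
apply: ge0_le_integral => //.
- by move=> x _; exact: poweR_ge0.
- exact: mp.
- by apply: measurableT_comp => //; exact: mp.
- move=> x _; rewrite /= lee_fin [leRHS]ger0_norm ?powR_ge0//.
  rewrite ge0_ler_powR ?nnegrE ?(ltW p0)// patchE.
  by case: ifPn => // _; rewrite normr0.
Qed.

(** Integrating [le_split_powR] with d = e over an interval of length b - a gives e (b - a) + e^(1 -
    p) e^p. The bound is linear in e, as the approximation argument requires. *)
Lemma integral_le_powR (h : R -> R) (e : R) : 0 < e ->
  measurable_fun setT (h \_ Omega) ->
  (\int[mu]_x (`|(h \_ Omega) x| `^ p)%:E <= (e `^ p)%:E)%E ->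
  (\int[mu]_(x in Omega) `|h x|%:E <= (e * (b - a + 1))%:E)%E.
Proof.
move=> e0 mh he.
have mp : measurable_fun setT (fun x => (`|(h \_ Omega) x| `^ p)%:E).
  apply/measurable_EFinP.
  by apply: (measurableT_comp (measurable_powR _)); exact: measurableT_comp.
have c0 : 0 <= e `^ (1 - p) by exact: powR_ge0.
apply: (@le_trans _ _ (\int[mu]_(x in Omega)
    (e%:E + (e `^ (1 - p))%:E * (`|(h \_ Omega) x| `^ p)%:E))%E).
  have -> : (\int[mu]_(x in Omega) `|h x|%:E =
      \int[mu]_(x in Omega) `|(h \_ Omega) x|%:E)%E.
    by apply: eq_integral => x xO; rewrite patchE xO.
  apply: ge0_le_integral => //.
  - by apply/measurable_EFinP; apply: measurable_funTS; exact: measurableT_comp.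
  - by apply: emeasurable_funD => //; apply: measurable_funeM; exact: measurable_funTS.
  - by move=> x _; rewrite -EFinM -EFinD lee_fin; exact: le_split_powR.
rewrite ge0_integralD//; last 3 first.
- by move=> x _; rewrite lee_fin ltW.
- by move=> x _; rewrite mule_ge0// lee_fin powR_ge0.
- by apply: measurable_funeM; exact: measurable_funTS.
rewrite integral_cst//= lebesgue_measure_itv/= lte_fin ab.
rewrite mulrDr mulr1 EFinD leeD//.
rewrite ge0_integralZl//; last exact: measurable_funTS.
apply: (@le_trans _ _ ((e `^ (1 - p))%:E * (e `^ p)%:E)%E).
  rewrite lee_wpmul2l ?lee_fin//; apply: le_trans he.
  by apply: ge0_subset_integral => // x _; rewrite lee_fin powR_ge0.
by rewrite -EFinM -powRD ?subrK ?powRr1 ?(ltW e0) ?(gt_eqF e0) ?implybT.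
Qed.

Lemma Lp_integrable (u : R -> R) : Lp Omega p u ->
  mu.-integrable setT (EFin \o u \_ Omega).
Proof.
move=> Lu; have mO' := Lp_measurable Lu.
have /integrableP[_ iu] := Lp_integrable_powR Lu.
rewrite -restrict_EFin -integrable_mkcond//.
apply/integrableP; split.
  by apply/measurable_EFinP; apply/(measurable_restrictT _ mO).
set I := (\int[mu]_x (`|(u \_ Omega) x| `^ p)%:E)%E.
have I0 : (0 <= I)%E by apply: integral_ge0 => x _; rewrite lee_fin powR_ge0.
have Ify : I \is a fin_num.
  rewrite ge0_fin_numE//; apply: le_lt_trans iu.
  by under [leRHS]eq_integral do rewrite gee0_abs ?lee_fin ?powR_ge0//.
(* With I the integral of |u|^p, the level e = I + 1 is at least 1, so I is at most e^p and the
   previous estimate applies. *)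
have e1 : 1 <= fine I + 1 by rewrite lerDr fine_ge0.
apply: le_lt_trans (integral_le_powR (e := fine I + 1) _ mO' _) (ltry _).
  exact: lt_le_trans e1.
rewrite -/I -(fineK Ify) lee_fin (le_trans _ (le1r_powR e1 p1))//.
by rewrite lerDl.
Qed.

(** The two terms under the p-th root are nonnegative, so each is at most e^p. *)
Lemma W1p_norm_lt (u v : R -> R) (e : R) : 0 < e ->
  (W1p_norm Omega p u v < e%:E)%E ->
  (\int[mu]_x (`|(u \_ Omega) x| `^ p)%:E <= (e `^ p)%:E)%E /\
  (\int[mu]_x (`|(v \_ Omega) x| `^ p)%:E <= (e `^ p)%:E)%E.
Proof.
have N_E (f : R -> R) : (Lp_norm Omega p f `^ p =
    \int[mu]_x (`|(f \_ Omega) x| `^ p)%:E)%E.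
  by rewrite /Lp_norm poweR_Lnorm ?gt_eqF.
have N0 (f : R -> R) : (0 <= Lp_norm Omega p f `^ p)%E by exact: poweR_ge0.
move=> e0 uve; rewrite -!N_E.
suff : (Lp_norm Omega p u `^ p + Lp_norm Omega p v `^ p <= (e `^ p)%:E)%E.
  by move=> H; split; apply: le_trans H; rewrite ?leeDl ?leeDr.
(* The sum is written as the p-th power of its p-th root, to which the hypothesis applies by
   monotonicity. *)
rewrite -poweR_EFin -[leLHS]poweRe1 ?adde_ge0//.
rewrite -(@mulVf _ p) ?gt_eqF// poweRrM.
apply: gt0_ler_poweR; rewrite ?(ltW p0)// ?in_itv/= ?leey ?andbT ?poweR_ge0//.
  by rewrite lee_fin ltW.
exact: ltW.
Qed.

Lemma bounded_integral_le (f g : R -> R) (B M : R) : 0 <= B ->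
  mu.-integrable Omega (EFin \o f) -> measurable_fun Omega g -> (forall x, `|g x| <= B) ->
  (\int[mu]_(x in Omega) `|f x|%:E <= M%:E)%E ->
  `|\int[mu]_(x in Omega) (f x * g x)| <= B * M.
Proof.
move=> B0 fi mg gB fM.
have /integrableP[/measurable_EFinP mf _] := fi.
have iB : mu.-integrable Omega (EFin \o (fun x => B * `|f x|)).
  exact: (integrableZl mO B (f := EFin \o (fun x => `|f x|)) (integrable_abse fi)).
have ifg : mu.-integrable Omega (EFin \o (fun x => f x * g x)).
  apply: (le_integrable mO _ _ iB).
    by apply/measurable_EFinP; exact: measurable_funM.
  move=> x _; rewrite /= lee_fin normrM mulrC [leRHS]ger0_norm ?mulr_ge0//.
  by rewrite ler_wpM2r.
apply: (le_trans (le_normr_Rintegral mO ifg)).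
apply: (@le_trans _ _ (\int[mu]_(x in Omega) (B * `|f x|))).
  apply: le_Rintegral => //; first exact: (integrable_abse ifg).
  by move=> x _; rewrite normrM mulrC ler_wpM2r.
rewrite RintegralZl//; last exact: (integrable_abse fi).
rewrite ler_wpM2l// -lee_fin /Rintegral fineK//.
exact: (integrable_fin_num mO (integrable_abse fi)).
Qed.


End Lp_spaces.

(** * Integration by parts in W^{1,p}_0 and the weak identity for convolutions *)

Section sobolev.
Context {R : realType}.
Local Notation mu := (@lebesgue_measure R).
Variables (a b p : R).
Hypotheses (ab : a < b) (p1 : 1 <= p).
Local Notation Omega := (`]a, b[%classic : set R).

Let mO : measurable (Omega : set (measurableTypeR R)). Proof. exact: measurable_itv. Qed.

Let Lp_integrableO (u : R -> R) : Lp Omega p u -> mu.-integrable Omega (EFin \o u).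
Proof.
by move=> /(Lp_integrable ab p1); rewrite -restrict_EFin -integrable_mkcond.
Qed.

Let integrableM (f g : R -> R) (B : R) : mu.-integrable Omega (EFin \o f) ->
  continuous g -> (forall x, `|g x| <= B) ->
  mu.-integrable Omega (EFin \o (fun x => f x * g x)).
Proof.
move=> fi cg gB.
have mg : measurable_fun setT g by exact: continuous_measurable_fun.
move: fi; rewrite integrable_mkcond// restrict_EFin => fi.
have := integrableM_bounded fi mg gB.
rewrite [in X in _ -> X]integrable_mkcond// restrict_EFin.
apply: eq_integrable => // x _ /=; rewrite !patchE.
by case: ifP => // _; rewrite mul0r.
Qed.

Let continuous_bounded_integrable (f : R -> R) (B : R) : continuous f ->
  (forall x, `|f x| <= B) -> mu.-integrable Omega (EFin \o f).
Proof.
move=> cf fB.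
apply: measurable_bounded_integrable => //.
- by rewrite /= lebesgue_measure_itv/= lte_fin ab -EFinB ltry.
- by apply: measurable_funTS; exact: continuous_measurable_fun.
- exists B; split; first exact: num_real.
  by move=> M BM x _; exact: le_trans (fB x) (ltW BM).
Qed.

(** The identity holds for test functions, and for fixed bounded G and g both sides are continuous
    in the W^{1,p} norm. Unlike in the definition of the weak derivative, G need not vanish near the
    end points; the approximation of u makes up for this. *)
Lemma W1p_0_by_parts (u v G g : R -> R) (B : R) :
  Lp Omega p u -> Lp Omega p v ->
  (forall e : R, 0 < e -> exists2 phi, test_function Omega phi &
    (W1p_norm Omega p (u \- phi)%R (v \- derive1 phi)%R < e%:E)%E) ->
  (forall x : R, is_derive x 1 G (g x)) -> continuous g ->
  (forall x, `|G x| <= B) -> (forall x, `|g x| <= B) ->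
  \int[mu]_(x in Omega) (v x * G x) = - \int[mu]_(x in Omega) (u x * g x).
Proof.
move=> Lu Lv approx dG cg GB gB.
have cG : continuous G.
  by move=> x; apply/differentiable_continuous/derivable1_diffP; have [] := dG x.
have B0 : 0 <= B by exact: le_trans (GB 0).
have mcont (f : R -> R) : continuous f -> measurable_fun Omega f.
  by move=> cf; apply: measurable_funTS; exact: continuous_measurable_fun.
pose E := \int[mu]_(x in Omega) (v x * G x) + \int[mu]_(x in Omega) (u x * g x).
suff : E = 0 by move=> /eqP; rewrite addr_eq0 => /eqP.
have E_le (e : R) : 0 < e -> `|E| <= e * (2 * (B * (b - a + 1))).
  move=> e0; have [phi tphi /(W1p_norm_lt p1 e0)[un vn]] := approx e e0.
  have cphi := continuous_test_function tphi.
  have cphi' := continuous_derive_test_function tphi.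
  have [C phiC] := continuous_eq0_bounded ab cphi (test_function_eq0 tphi).
  have [C' phiC'] := continuous_eq0_bounded ab cphi' (derive_test_function_eq0 tphi).
  have iphi := continuous_bounded_integrable cphi phiC.
  have iphi' := continuous_bounded_integrable cphi' phiC'.
  have iuphi : mu.-integrable Omega (EFin \o (u \- phi)).
    exact: (integrableB mO (Lp_integrableO Lu) iphi).
  have ivphi : mu.-integrable Omega (EFin \o (v \- derive1 phi)).
    exact: (integrableB mO (Lp_integrableO Lv) iphi').
  have mpatch (h : R -> R) : mu.-integrable Omega (EFin \o h) ->
      measurable_fun setT (h \_ Omega).
    move=> /integrableP[/measurable_EFinP mh _].
    exact/(measurable_restrictT _ mO).
  (* The defect E is linear in the pair (u, v) and vanishes at ([phi], [phi]'), so it can be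
     computed on the differences. *)
  have -> : E = \int[mu]_(x in Omega) ((v \- derive1 phi) x * G x) +
                \int[mu]_(x in Omega) ((u \- phi) x * g x).
    have split_int (f h k : R -> R) : mu.-integrable Omega (EFin \o f) ->
        mu.-integrable Omega (EFin \o h) -> continuous k -> (forall x, `|k x| <= B) ->
        \int[mu]_(x in Omega) ((f \- h) x * k x) =
        \int[mu]_(x in Omega) (f x * k x) - \int[mu]_(x in Omega) (h x * k x).
      move=> fi hi ck kB; rewrite -RintegralB//; [|exact: integrableM kB..].
      by apply: eq_Rintegral => x _; rewrite mulrBl.
    rewrite !split_int//; [|exact: Lp_integrableO..].
    rewrite (test_function_by_parts ab tphi dG cg) /E; ring.
  rewrite (le_trans (ler_normD _ _))// mulr_natl mulr2n mulrDr mulrCA lerD//.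
  - apply: bounded_integral_le => //; first exact: mcont.
    exact: (integral_le_powR ab p1 e0 (mpatch _ ivphi) vn).
  - apply: bounded_integral_le => //; first exact: mcont.
    exact: (integral_le_powR ab p1 e0 (mpatch _ iuphi) un).
have K0 : 0 <= 2 * (B * (b - a + 1)).
  by rewrite !mulr_ge0// addr_ge0// subr_ge0 ltW.
(* If E were nonzero, e = |E| / (M + 1), with M the factor of e in [E_le], would give |E| at most
   |E| M / (M + 1). The 1 in the denominator ensures a strict contradiction. *)
apply/eqP; rewrite -normr_eq0; apply: contraT => E0.
have {}E0 : 0 < `|E| by rewrite lt_def E0 normr_ge0.
have K1 : 0 < 2 * (B * (b - a + 1)) + 1 by rewrite ltr_wpDl.
have := E_le (`|E| / (2 * (B * (b - a + 1)) + 1)) (divr_gt0 E0 K1).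
by rewrite mulrAC ler_pdivlMr// ler_pM2l// gerDl ler10.
Qed.

(** The common core of both signs, with k the cut-off kernel or its reflection. The witness w is c
    times the adjoint of K applied to v extended by zero; moving K onto [phi] and integrating by
    parts gives the identity. *)
Lemma weak_kernel_op (k : R -> R) (c : R) (u : R -> R) : (forall x, 0 <= k x) ->
  mu.-integrable setT (EFin \o k) -> W1p_0 Omega p u ->
  exists w, [/\ Lp Omega p w, locally_integrable Omega w &
    forall phi, test_function Omega phi ->
      \int[mu]_(x in Omega) (w x * phi x) =
      \int[mu]_(x in Omega) (u x * (- c * kernel_op k (derive1 phi) x))].
Proof.
move=> k0 ik [[Lu _] [v [Lv _ approx]]].
pose vO := v \_ Omega.
have ivO : mu.-integrable setT (EFin \o vO) by exact: Lp_integrable Lv.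
pose k' := k \o -%R.
have k'0 x : 0 <= k' x by exact: k0.
have ik' : mu.-integrable setT (EFin \o k') by exact: integrable_reflection.
pose w0 := kernel_op k' vO.
have mw0 : measurable_fun setT w0 by exact: measurable_kernel_op.
have iw0 : mu.-integrable setT (fun x => (`|w0 x| `^ p)%:E).
  by apply: integrable_kernel_op_powR => //; exact: Lp_integrable_powR.
have Lw0 : Lp Omega p w0 by exact: Lp_intro.
have Lw : Lp Omega p (fun x => c * w0 x).
  apply: Lp_intro => //; first exact: measurable_funM.
  have := integrableZl measurableT (`|c| `^ p) iw0.
  by apply: eq_integrable => // x _; rewrite normrM powRM.
exists (fun x => c * w0 x); split => //.
  apply: open_integrable_locally; first exact: interval_open.
  exact: Lp_integrableO.
move=> phi tphi.
have cphi := continuous_test_function tphi.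
have cphi' := continuous_derive_test_function tphi.
have [C phiC] := continuous_eq0_bounded ab cphi (test_function_eq0 tphi).
have [C' phiC'] := continuous_eq0_bounded ab cphi' (derive_test_function_eq0 tphi).
have mphi : measurable_fun setT phi by exact: continuous_measurable_fun.
have mphi' : measurable_fun setT (derive1 phi) by exact: continuous_measurable_fun.
have dphi := derivable_test_function tphi.
have dG (x : R) := is_derive_kernel_op k0 ik x dphi phiC cphi' phiC'.
have cg := continuous_kernel_op k0 ik cphi' phiC'.
have GC := kernel_op_bounded k0 ik mphi phiC.
have gC := kernel_op_bounded k0 ik mphi' phiC'.
(* [W1p_0_by_parts] takes a single bound for G and its derivative. *)
pose B := Num.max (C * \int[mu]_t k t) (C' * \int[mu]_t k t).
have GB x : `|kernel_op k phi x| <= B by rewrite le_max GC.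
have gB x : `|kernel_op k (derive1 phi) x| <= B by rewrite le_max gC orbT.
have := W1p_0_by_parts Lu Lv approx dG cg GB gB.
have -> : \int[mu]_(x in Omega) (v x * kernel_op k phi x) = \int[mu]_x (phi x * w0 x).
  rewrite (kernel_op_adjoint k'0 ik' ivO mphi phiC).
  rewrite (_ : k' \o -%R = k); last by apply/funext => x; rewrite /k'/= opprK.
  rewrite Rintegral_mkcond; apply: eq_Rintegral => x _; rewrite /vO !patchE.
  by case: ifP => // _; rewrite mul0r.
(* The function w0 may be nonzero outside the interval, but [phi] vanishes there. *)
have -> : \int[mu]_x (phi x * w0 x) = \int[mu]_(x in Omega) (w0 x * phi x).
  rewrite [RHS]Rintegral_mkcond; apply: eq_Rintegral => x _; rewrite patchE mem_setE mulrC.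
  by case: ifPn => // /(test_function_eq0 tphi) ->; rewrite mulr0.
move=> E.
transitivity (c * \int[mu]_(x in Omega) (w0 x * phi x)).
  rewrite -RintegralZl//; first by apply: eq_Rintegral => x _; rewrite mulrA.
  exact: (integrableM (Lp_integrableO Lw0) cphi phiC).
rewrite E mulrN -mulNr -RintegralZl//.
  by apply: eq_Rintegral => x _; rewrite mulrCA.
exact: (integrableM (Lp_integrableO Lu) cg gB).
Qed.

End sobolev.

(** * Fractional derivatives of test functions as convolutions *)

Section fractional_kernel.
Context {R : realType}.
Local Notation mu := (@lebesgue_measure R).
Variables (a b alpha : R).
Hypotheses (ab : a < b) (alpha0 : 0 < alpha) (alpha1 : alpha < 1).

(** The bare power is not integrable at infinity. Cutting at b - a changes nothing for test
    functions seen from inside the interval, two of whose points are always less than b - a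
    apart. *)
Definition frac_kernel : R -> R :=
  (fun t => t `^ (- alpha)) \_ (`]0, (b - a)[%classic : set R).

Lemma frac_kernel_ge0 t : 0 <= frac_kernel t.
Proof. by rewrite /frac_kernel patchE; case: ifP => // _; exact: powR_ge0. Qed.

Lemma integrable_frac_kernel : mu.-integrable setT (EFin \o frac_kernel).
Proof.
rewrite -restrict_EFin -integrable_mkcond; last exact: measurable_itv.
by apply: integrable_powR_oo => //; rewrite ?subr_gt0// ltW.
Qed.

(** The point [y - t] or [y + t] is where the fractional integral is evaluated, for the right and
    the left derivative respectively. If t is at least b - a while that point lies in ]a, b[, then y
    lies outside and phi(y) = 0, so the cut-off is harmless. *)
Lemma frac_kernelM (phi : R -> R) (y t : R) : test_function (`]a, b[) phi ->
  (y - t \in `]a, b[) \/ (y + t \in `]a, b[) ->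
  frac_kernel t * phi y = (if 0 < t then phi y / t `^ alpha else 0).
Proof.
move=> tphi zab; rewrite /frac_kernel patchE mem_setE in_itv/=.
case: ltP => t0 /=; last by rewrite mul0r.
have [tT|Tt] := ltP t (b - a); first by rewrite powRN mulrC.
rewrite (test_function_eq0 tphi) ?mulr0 ?mul0r//.
apply/negP; rewrite in_itv/= => /andP[ay yb].
by case: zab; rewrite in_itv/= => /andP[]; lra.
Qed.

(** The fractional integral F agrees with the cut-off convolution only on ]a, b[. This interval
    being open, they agree near x and have the same derivative there. *)
Lemma derive1_kernel_op_oo (k phi F : R -> R) (x : R) : (forall t, 0 <= k t) ->
  mu.-integrable setT (EFin \o k) -> test_function (`]a, b[) phi ->
  (forall z, z \in `]a, b[ -> F z = kernel_op k phi z) -> x \in `]a, b[ ->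
  derive1 F x = kernel_op k (derive1 phi) x.
Proof.
move=> k0 ik tphi Fk xab.
have cphi := continuous_test_function tphi.
have cphi' := continuous_derive_test_function tphi.
have [C phiC] := continuous_eq0_bounded ab cphi (test_function_eq0 tphi).
have [C' phiC'] := continuous_eq0_bounded ab cphi' (derive_test_function_eq0 tphi).
have [_ <-] := is_derive_kernel_op k0 ik x (derivable_test_function tphi) phiC cphi' phiC'.
rewrite derive1E; apply: near_eq_derive.
by have := near_in_itvoo xab; apply: filterS.
Qed.

Lemma right_frac_derivativeE (phi : R -> R) (x : R) : test_function (`]a, b[) phi ->
  x \in `]a, b[ -> right_frac_derivative alpha phi x =
  - (Gamma (1 - alpha))^-1 * kernel_op frac_kernel (derive1 phi) x.
Proof.
move=> tphi xab; congr (_ * _); apply: derive1_kernel_op_oo => //.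
- exact: frac_kernel_ge0.
- exact: integrable_frac_kernel.
move=> z zab; rewrite Rintegral_mkcond; apply: eq_Rintegral => y _.
rewrite (frac_kernelM (y := y) (t := - z + y) tphi); last first.
  by left; rewrite opprD opprK addrC addrNK.
by rewrite patchE mem_setE in_itv/= andbT [- z + y]addrC subr_gt0.
Qed.

Lemma left_frac_derivativeE (phi : R -> R) (x : R) : test_function (`]a, b[) phi ->
  x \in `]a, b[ -> left_frac_derivative alpha phi x =
  (Gamma (1 - alpha))^-1 * kernel_op (frac_kernel \o -%R) (derive1 phi) x.
Proof.
move=> tphi xab; congr (_ * _); apply: derive1_kernel_op_oo => //.
- by move=> t; exact: frac_kernel_ge0.
- exact: integrable_reflection integrable_frac_kernel.
move=> z zab; rewrite Rintegral_mkcond; apply: eq_Rintegral => y _.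
rewrite /comp (_ : - (- z + y) = z - y); last by rewrite opprD opprK.
rewrite (frac_kernelM (y := y) (t := z - y) tphi); last by right; rewrite addrC addrNK.
by rewrite patchE mem_setE in_itv/= subr_gt0.
Qed.

End fractional_kernel.

Theorem theorem4p36 (R : realType) (a b alpha p : R)
    (hab : a < b) (halpha0 : 0 < alpha) (halpha1 : alpha < 1) (hp : 1 <= p) :
  [/\ W1p_0 `]a, b[ p `<=` left_Wap `]a, b[ alpha p,
      W1p_0 `]a, b[ p `<=` right_Wap `]a, b[ alpha p
    & W1p_0 `]a, b[ p `<=` Wap `]a, b[ alpha p].
Proof.
have ik := integrable_frac_kernel hab halpha0 halpha1.
have k0 := @frac_kernel_ge0 R a b alpha.
have L1 u : W1p_0 `]a, b[ p u -> Lp `]a, b[ 1 u.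
  by move=> [[Lu _] _]; apply/Lfun1_integrable; exact: Lp_integrable Lu.
have left_sub : W1p_0 `]a, b[ p `<=` left_Wap `]a, b[ alpha p.
  move=> u Wu; split; first by have [[]] := Wu.
  have [w [Lw lw wE]] := weak_kernel_op hab hp (Gamma (1 - alpha))^-1 k0 ik Wu.
  exists w => //; split => [|//|phi tphi]; first exact: L1.
  rewrite wE//; apply: eq_Rintegral => x /set_mem xab.
  by rewrite (right_frac_derivativeE hab halpha0 halpha1 tphi xab).
have right_sub : W1p_0 `]a, b[ p `<=` right_Wap `]a, b[ alpha p.
  move=> u Wu; split; first by have [[]] := Wu.
  (* The left derivative has the opposite sign in front of 1/Gamma(1 - alpha) and the reflected
     kernel; hence the negated constant, undone by [opprK] below. *)
  have [w [Lw lw wE]] := weak_kernel_op hab hp (- (Gamma (1 - alpha))^-1)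
    (fun x => k0 (- x)) (integrable_reflection ik) Wu.
  exists w => //; split => [|//|phi tphi]; first exact: L1.
  rewrite wE//; apply: eq_Rintegral => x /set_mem xab.
  by rewrite (left_frac_derivativeE hab halpha0 halpha1 tphi xab) opprK.
by split => // u Wu; split; [exact: left_sub|exact: right_sub].
Qed.
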